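(* Let $G$ be a connected block graph with center $C$, and let $d=\mathrm{diam}(G)\ge 2$. Then $\chi_{\mu_{d-1}}(G)=\chi_{\mu}(G)$ if and only if $\deg^\ast(C)\le \left\lceil \frac{d+1}{2}\right\rceil$.
   Context: A block of $G$ is a maximal connected subgraph without a cut-vertex; $G$ is a block graph if all its blocks are cliques. The eccentricity of $v$ is $\epsilon_G(v)=\max_u d_G(u,v)$, the radius $\mathrm{rad}(G)$ is the minimum eccentricity, and the center $C$ is the set of vertices of minimum eccentricity (in a block graph it induces a clique). A vertex $u$ is a radial vertex if $d_G(u,x)=\mathrm{rad}(G)$ for some $x\in C$. If $|C|\ge 2$, $\deg^\ast(C)$ is the number of components of $G-E(G[C])$ that contain a radial vertex; if $C=\{c\}$ and $F$ is the set of edges incident with $c$, $\deg^\ast(C)$ is the number of components of $G-F$ containing a radial vertex. A set $M\subseteq V(G)$ is a mutual-visibility set if for every $u,v\in M$ there is a shortest $u,v$-path none of whose internal vertices lies in $M$; it is a $k$-distance mutual-visibility set if moreover such a path can be chosen of length at most $k$. $\chi_\mu(G)$ (resp. $\chi_{\mu_k}(G)$) is the minimum cardinality of a partition of $V(G)$ into mutual-visibility sets (resp. $k$-distance mutual-visibility sets). *)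

(* Defs.v *)
(* Finite simple graphs as a symmetric irreflexive relation
   e : rel T on a finType T. *)
From mathcomp Require Import all_boot.
Set Implicit Arguments. Unset Strict Implicit. Unset Printing Implicit Defensive.

Section Graphs.
Variable T : finType.
Implicit Types (e : rel T) (S M : {set T}).

Definition connected_graph e : Prop := forall x y : T, connect e x y.

Definition walkb e (x y : T) (n : nat) : bool :=
  [exists p : n.-tuple T, path e x p && (last x p == y)].

(* distance d_G(x,y): least length of an x,y-walk (= of an x,y-path);
   in a connected graph it is < #|T|.  (Value #|T| if no walk exists.) *)
Definition dist e (x y : T) : nat := find (walkb e x y) (iota 0 #|T|).

Definition ecc e (v : T) : nat := \max_(u : T) dist e u v.
Definition rad e : nat := \big[minn/#|T|]_(v : T) ecc e v.
Definition diam e : nat := \max_(u : T) \max_(v : T) dist e u v.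
Definition center e : {set T} := [set v | ecc e v == rad e].

Definition radial e (u : T) : bool := [exists x in center e, dist e u x == rad e].

Definition rel_in e S : rel T := [rel x y | [&& e x y, x \in S & y \in S]].
Definition conn_in e S : Prop :=
  forall x y, x \in S -> y \in S -> connect (rel_in e S) x y.

Definition biconn e S : Prop :=
  S != set0 /\ conn_in e S /\ (forall v, v \in S -> conn_in e (S :\ v)).

Definition block e S : Prop :=
  biconn e S /\ (forall S', S \subset S' -> biconn e S' -> S' = S).

Definition is_clique e S : Prop := forall x y, x \in S -> y \in S -> x != y -> e x y.

Definition block_graph e : Prop := forall B, block e B -> is_clique e B.

Definition cut_rel e : rel T :=
  let C := center e in
  if 2 <= #|C| then [rel x y | e x y && ~~ ((x \in C) && (y \in C))]
  else [rel x y | e x y && ~~ ((x \in C) || (y \in C))].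
Definition degstar e : nat :=
  #|[set [set y | connect (cut_rel e) u y] | u in [set u | radial e u]]|.

(* p (the vertex list after u) is a u,v-path of length dist u v, i.e. a shortest
   u,v-path, whose internal vertices avoid M *)
Definition vis_path e M (u v : T) (p : seq T) : bool :=
  [&& path e u p, last u p == v & all (fun w => w \notin M) (take (size p).-1 p)].

Definition mvis e M : bool :=
  [forall u in M, forall v in M,
     [exists p : (dist e u v).-tuple T, vis_path e M u v p]].

Definition mvis_k e (k : nat) M : bool :=
  [forall u in M, forall v in M,
     [exists p : (dist e u v).-tuple T, vis_path e M u v p && (dist e u v <= k)]].

Definition part_num (good : pred {set T}) : nat :=
  \big[minn/#|T|]_(P : {set {set T}} |
       partition P [set: T] && [forall B in P, good B]) #|P|.

Definition chi_mu e : nat := part_num (mvis e).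
Definition chi_mu_k e (k : nat) : nat := part_num (mvis_k e k).

End Graphs.

(* Main.v *)
(* In a block graph two neighbours of a vertex [w] that are joined by a path
   avoiding [w] are adjacent, since they lie with [w] on a cycle.  Hence an inner
   vertex [w] of a geodesic separates its ends, and for every [z] it lies between
   [z] and one of the two ends ([btw_gate]).  It follows that mutual-visibility
   sets are exactly the sets without three vertices on a common geodesic, that the
   eccentricity is strictly quasi-convex along geodesics, and that the center is a
   clique with diam = 2 rad if |C| = 1 and diam = 2 rad - 1 otherwise.

   A diametral geodesic meets each class at most twice, and the levels of the
   eccentricity are mutual-visibility sets, so chi_mu = diam - rad + 1 =
   ceil((diam + 1) / 2).  Radial vertices of distinct components are at distance
   diam, so chi_(mu_(diam-1)) >= deg^*.  Conversely, if deg^* <= diam - rad + 1, the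
   only pairs at distance diam are radial vertices of distinct components; exchanging,
   in the j-th such component, the top level with level j separates all of them, and
   the classes still contain no three vertices of a geodesic. *)
Require Import Defs.
From mathcomp Require Import all_boot zify.
Set Implicit Arguments. Unset Strict Implicit. Unset Printing Implicit Defensive.

(** * Attained minima and partition numbers *)

Lemma bigminn_leq (I : finType) (P : pred I) (F : I -> nat) n j :
  P j -> \big[minn/n]_(i | P i) F i <= F j.
Proof.
move=> Pj; have : j \in index_enum I by exact: mem_index_enum.
elim: (index_enum I) => // i r IHr; rewrite inE big_cons => /predU1P[<-|/IHr le].
  by rewrite Pj geq_minl.
by case: ifP => // _; rewrite geq_min le orbT.
Qed.

(** The default [n] takes part in the minimum; a value at most [n] guarantees that some index
    attains it. *)
Lemma bigminn_attained (I : finType) (P : pred I) (F : I -> nat) n j :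
  P j -> F j <= n -> exists2 i, P i & F i = \big[minn/n]_(i | P i) F i.
Proof.
move=> Pj Fj.
have [def_n|//] : \big[minn/n]_(i | P i) F i = n \/
    exists2 i, P i & F i = \big[minn/n]_(i | P i) F i.
  pose K m := m = n \/ exists2 i, P i & F i = m.
  apply: (big_ind K) => [|a b Ka Kb|i Pi]; first by left.
    by rewrite /minn; case: ifP.
  by right; exists i.
by exists j => //; apply/eqP; rewrite eqn_leq {1}def_n Fj bigminn_leq.
Qed.

Section PartitionNumber.
Variables (T : finType) (good : pred {set T}).

Lemma part_num_leq (f : T -> nat) k : (forall x, f x < k) ->
  (forall x, good [set y | f x == f y]) -> part_num good <= minn k #|T|.
Proof.
move=> fk gf; pose P := preim_partition f [set: T].
have PE : P = [set [set y | f x == f y] | x in [set: T]].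
  by apply: eq_imset => x; apply/setP => y; rewrite !inE.
have le : part_num good <= #|P|.
  apply: (@bigminn_leq _ _ (fun P : {set {set T}} => #|P|)).
  rewrite preim_partitionP; apply/forall_inP => B; rewrite PE => /imsetP[x _ ->].
  exact: gf.
apply: leq_trans le _; rewrite leq_min PE -(cardsT T) leq_imset_card andbT.
have -> : [set [set y | f x == f y] | x in [set: T]] =
    [set [set y | val i == f y] | i in [set Ordinal (fk x) | x in [set: T]]].
  by rewrite -imset_comp.
apply: leq_trans (leq_imset_card _ _) _.
by rewrite -[X in _ <= X]card_ord max_card.
Qed.

(** The partition into singletons is admissible and its size does not exceed the default [#|T|]. *)
Lemma part_num_attained : (forall x, good [set x]) ->
  exists P, [/\ partition P [set: T], {in P, forall B, good B} & #|P| = part_num good].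
Proof.
move=> g1; pose P0 := preim_partition id [set: T].
have PE : P0 = [set [set x] | x in [set: T]].
  by apply: eq_imset => x; apply/setP => y; rewrite !inE eq_sym.
have [||P /andP[pP /forall_inP gP] cP] :=
    @bigminn_attained _ (fun P : {set {set T}} =>
      partition P [set: T] && [forall B in P, good B]) (fun P => #|P|) #|T| P0.
- rewrite preim_partitionP; apply/forall_inP => B; rewrite PE => /imsetP[x _ ->].
  exact: g1.
- by rewrite PE -(cardsT T) leq_imset_card.
by exists P.
Qed.

End PartitionNumber.

Definition swap (a b n : nat) := if n == a then b else if n == b then a else n.

Lemma swap_inj a b : injective (swap a b).
Proof. by move=> m n; rewrite /swap; do !case: eqP; lia. Qed.

Section BlockGraph.
Variables (T : finType) (e : rel T).
Hypothesis e_sym : symmetric e.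
Hypothesis e_irr : irreflexive e.
Hypothesis G_conn : connected_graph e.
Hypothesis G_block : block_graph e.
Local Notation dist := (dist e).

(** * Distances, betweenness and geodesics *)

Lemma dist_path x y : exists p, [/\ path e x p, last x p = y & size p = dist x y].
Proof.
(* A duplicate-free path has fewer than [#|T|] edges, so the search in [dist] succeeds. *)
have hw : has (walkb e x y) (iota 0 #|T|).
  have /connectP [p0 /shortenP[p ep up _] lp] := G_conn x y.
  apply/hasP; exists (size p).
    by rewrite mem_iota add0n /= (leq_trans _ (max_card (mem (x :: p)))) // (card_uniqP up).
  by apply/existsP; exists (in_tuple p) => /=; rewrite ep -lp eqxx.
have := nth_find 0 hw; move: (hw); rewrite has_find size_iota => lt.
rewrite nth_iota // add0n => /existsP[p /andP[ep /eqP lp]].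
by exists p; rewrite ep lp size_tuple.
Qed.

Lemma dist_min x p : path e x p -> dist x (last x p) <= size p.
Proof.
move=> ep; rewrite leqNgt; apply/negP => lt.
have ltT : size p < #|T|.
  by apply: leq_trans lt _; rewrite -[X in _ <= X](size_iota 0) find_size.
suff : walkb e x (last x p) (size p).
  by have := before_find 0 lt; rewrite nth_iota // add0n => ->.
by apply/existsP; exists (in_tuple p) => /=; rewrite ep eqxx.
Qed.

Lemma dist_xx x : dist x x = 0.
Proof. by apply/eqP; rewrite -leqn0 (dist_min (p := [::])). Qed.

Lemma dist_eq0 x y : (dist x y == 0) = (x == y).
Proof.
apply/eqP/eqP => [d0|->]; last exact: dist_xx.
by have [p []] := dist_path x y; rewrite d0 => _ lp /size0nil p0; rewrite -lp p0.
Qed.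

Lemma dist_triangle z x y : dist x y <= dist x z + dist z y.
Proof.
have [p [ep lp <-]] := dist_path x z; have [q [eq lq <-]] := dist_path z y.
rewrite -size_cat -lq -lp -last_cat; apply: dist_min.
by rewrite cat_path ep lp.
Qed.

Lemma dist_sym x y : dist x y = dist y x.
Proof.
suff le a b : dist a b <= dist b a by apply/eqP; rewrite eqn_leq !le.
have [p [ep lp <-]] := dist_path b a.
case: p ep lp => [_ <-|c p ep lp] /=; first by rewrite dist_xx.
have := rev_path e b (c :: p); rewrite lp.
rewrite (eq_path (e' := e)); last by move=> ? ?; exact: e_sym.
rewrite ep => /dist_min; rewrite size_rev size_belast.
by rewrite rev_cons last_rcons.
Qed.

Lemma dist_edge x y : e x y -> dist x y <= 1.
Proof. by move=> exy; apply: (dist_min (p := [:: y])); rewrite /= exy. Qed.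

Lemma edge_of_dist x y : x != y -> dist x y <= 1 -> e x y.
Proof.
move=> xy; have [p [ep lp <-]] := dist_path x y.
case: p ep lp => [_ /eqP|z [|//]] /=; first by rewrite (negPf xy).
by rewrite andbT => exz <-.
Qed.

Definition btw u w v := dist u w + dist w v == dist u v.

Lemma btw_sym u w v : btw u w v = btw v w u.
Proof. by rewrite /btw addnC (dist_sym u w) (dist_sym w v) (dist_sym u v). Qed.

Lemma dist_split u v m n : dist u v = m + n ->
  exists w, [/\ btw u w v, dist u w = m & dist w v = n].
Proof.
move=> duv; have [p [ep lp sp]] := dist_path u v.
have : path e u (take m p ++ drop m p) by rewrite cat_take_drop.
rewrite cat_path; set w := last _ _ => /andP[/dist_min le1 /dist_min].
have -> : last w (drop m p) = v by rewrite -last_cat cat_take_drop.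
move: le1; rewrite -/w size_take size_drop sp duv => le1 le2.
have tri := dist_triangle w u v; rewrite duv in tri.
have le1' : dist u w <= m by move: le1; case: ifP; lia.
have le2' : dist w v <= n by lia.
by exists w; rewrite /btw duv; split; lia.
Qed.

Lemma next_vertex u v : u != v ->
  exists w, [/\ e u w, btw u w v, dist u w = 1 & (dist w v).+1 = dist u v].
Proof.
rewrite -dist_eq0 => nz.
have [|w [b d1 d2]] := @dist_split u v 1 (dist u v).-1; first lia.
exists w; split=> //; last lia.
by apply: edge_of_dist; rewrite -?dist_eq0 d1.
Qed.

Lemma path_btw u (p : seq T) (w : T) : path e u p -> dist u (last u p) = size p ->
  w \in p -> btw u w (last u p).
Proof.
move=> ep sp wp.
have [p1 [p2 def_p]] : exists p1 p2 : seq T, p = rcons p1 w ++ p2.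
  by case/splitPr: wp => p1 p2; exists p1, p2; rewrite cat_rcons.
move: ep sp; rewrite def_p cat_path last_cat last_rcons => /andP[ep1 ep2] sp.
have := dist_min ep1; have := dist_min ep2; rewrite last_rcons.
have := dist_triangle w u (last w p2).
by move: sp; rewrite /btw size_cat; lia.
Qed.

Lemma geodesic u v : exists w : nat -> T,
  forall i j, i <= j -> j <= dist u v -> dist (w i) (w j) = j - i.
Proof.
have [p [ep lp sp]] := dist_path u v; pose w i := nth u (u :: p) i.
have edge i : i < size p -> e (w i) (w i.+1) by exact: (pathP u ep).
have short n i : i + n <= size p -> dist (w i) (w (i + n)) <= n.
  elim: n => [|n IHn] le; first by rewrite addn0 dist_xx.
  have := dist_triangle (w (i + n)) (w i) (w (i + n.+1)).
  have := IHn; have := edge (i + n); rewrite addnS => /(_ ltac:(lia)) /dist_edge.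
  lia.
exists w => i j le_ij; rewrite -sp => le_j.
(* The three pieces cut off by [w i] and [w j] have upper bounds adding up to [dist u v], so each
   bound is attained. *)
have := short (j - i) i; have := short i 0; have := short (size p - j) j.
rewrite add0n !subnKC ?(leq_trans le_ij) //.
have -> : w (size p) = v by rewrite /w -last_nth.
have -> : w 0 = u by [].
have := dist_triangle (w i) u v; have := dist_triangle (w j) (w i) v.
rewrite -sp. lia.
Qed.

(** * Separation in block graphs *)

Lemma rel_in_path_connect (S : {set T}) a (s : seq T) : {subset a :: s <= S} ->
  path e a s -> {in a :: s, forall y, connect (rel_in e S) a y}.
Proof.
move=> sS es y ys; apply: (path_connect (p := s)) => //.
elim: s a sS es {ys} => [|b s IHs] a sS //= /andP[eab es].
apply/andP; split; first by rewrite /rel_in /= eab !sS ?inE ?eqxx ?orbT.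
by apply: IHs => // z zs; apply: sS; rewrite inE zs orbT.
Qed.

Lemma connect_rel_in_sym S x y : connect (rel_in e S) x y = connect (rel_in e S) y x.
Proof.
apply: (@sym_connect_sym T (rel_in e S)) => a b.
by rewrite /rel_in /= e_sym [(a \in S) && _]andbC.
Qed.

Lemma path_conn_in a (s : seq T) (S : {set T}) :
  S =i a :: s -> path e a s -> conn_in e S.
Proof.
move=> Ss es x y; rewrite !Ss => xs ys.
have sub : {subset a :: s <= S} by move=> z; rewrite Ss.
apply: (@connect_trans _ _ a); last exact: rel_in_path_connect ys.
by rewrite connect_rel_in_sym; exact: rel_in_path_connect xs.
Qed.

(** Rotating the cycle to start at the deleted vertex shows that the rest is a path. *)
Lemma cycle_biconn (c : seq T) : 0 < size c -> uniq c -> cycle e c ->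
  biconn e [set x in c].
Proof.
case: c => // a s _ us /[dup] cs /=; rewrite rcons_path => /andP[es _].
split; first by apply/set0Pn; exists a; rewrite !inE eqxx.
split; first by apply: (path_conn_in (a := a) (s := s)) => // x; rewrite inE.
move=> v; rewrite inE => /rot_to[i s' def_s'].
have us' : uniq (v :: s') by rewrite -def_s' rot_uniq.
have : cycle e (v :: s') by rewrite -def_s' rot_cycle.
rewrite /= rcons_path => /andP[es' _].
have mem x : (x \in [set x in a :: s] :\ v) = (x \in s').
  rewrite !inE -in_cons -(mem_rot i) def_s' inE.
  by case: eqP => // ->; move: us' => /= /andP[/negPf ->].
case: s' {def_s'} us' es' mem => [_ _ mem x y|b s' _ /= /andP[_ es'] mem].
  by rewrite mem.
exact: path_conn_in mem es'.
Qed.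

Lemma biconn_sub_block S : biconn e S -> exists2 B : {set T}, S \subset B & block e B.
Proof.
pose conn_inb (R : {set T}) := [forall x in R, forall y in R, connect (rel_in e R) x y].
have conn_inP R : reflect (conn_in e R) (conn_inb R).
  apply: (iffP 'forall_in_forall_inP) => h x; last by move=> xR y yR; exact: h.
  by move=> y xR yR; exact: h.
pose biconnb R := [&& R != set0, conn_inb R & [forall v in R, conn_inb (R :\ v)]].
have biconnP R : reflect (biconn e R) (biconnb R).
  apply: (iffP and3P) => [[R0 /conn_inP Rc /forall_inP Rv]|[R0 [Rc Rv]]].
    by split=> //; split=> // v /Rv /conn_inP.
  by split=> //; [exact/conn_inP | apply/forall_inP => v /Rv /conn_inP].
move=> /biconnP /maxset_exists[B /maxsetP[/biconnP bB maxB] sSB].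
by exists B => //; split=> // R sBR /biconnP bR; exact: maxB.
Qed.

Lemma cycle_clique (c : seq T) : uniq c -> cycle e c -> {in c &, forall x y, x != y -> e x y}.
Proof.
move=> uc cc x y xc yc; have c0 : 0 < size c by case: (c) xc.
have [B /subsetP sB /G_block] := biconn_sub_block (cycle_biconn c0 uc cc).
by apply; apply: sB; rewrite inE.
Qed.

(** A duplicate-free path from [p] to [q] avoiding [w] closes up through [w] to a cycle, and a cycle
    lies in one block. *)
Lemma neighbours_adjacent w p q : e w p -> e w q -> p != q ->
  connect (rel_in e [set~ w]) p q -> e p q.
Proof.
move=> ewp ewq pq /connectP[s0 /shortenP[s es us _] lq].
have es' : path e p s by apply: sub_path es => a b /and3P[].
have ws : w \notin s.
  elim: s p es {us lq es' ewp pq} => //= b s IHs a /andP[/and3P[_ _ bw] /IHs ws].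
  by rewrite inE negb_or ws andbT eq_sym; move: bw; rewrite !inE.
have wp : w != p by apply: contraTneq ewp => ->; rewrite e_irr.
apply: (@cycle_clique (w :: p :: s)) => //.
- by rewrite cons_uniq us andbT inE negb_or wp ws.
- by rewrite /= rcons_path ewp es' -lq e_sym.
- by rewrite !inE eqxx orbT.
- by rewrite in_cons lq mem_last orbT.
Qed.

Lemma geodesic_avoids u v w : ~~ btw u w v -> connect (rel_in e [set~ w]) u v.
Proof.
move=> nb; have [p [ep lp sp]] := dist_path u v; apply/connectP; exists p => //.
have wp : w \notin u :: p.
  rewrite inE negb_or; apply/andP; split; apply: contra nb.
    by move/eqP->; rewrite /btw dist_xx.
  by rewrite -lp => ?; apply: path_btw; rewrite ?lp.
elim: p u ep wp {nb lp sp} => //= b p IHp a /andP[eab ep].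
rewrite !inE !negb_or => /and3P[wa wb wp]; apply/andP; split.
  by rewrite /rel_in /= eab !inE ![_ == w]eq_sym wa.
by apply: IHp; rewrite // inE negb_or wb.
Qed.

(** Otherwise the neighbours [p], [q] of [w] towards [u] and [v] are joined via [u] and [v] without
    meeting [w], hence adjacent, which shortcuts the geodesic at [w]. *)
Lemma btw_separates u w v : btw u w v -> w != u -> w != v ->
  ~~ connect (rel_in e [set~ w]) u v.
Proof.
move=> b wu wv; apply/negP => cuv.
have [p [ewp bp dp1 dp]] := next_vertex wu.
have [q [ewq bq dq1 dq]] := next_vertex wv.
have tri := dist_triangle p u v; have tri' := dist_triangle q p v.
have sdup := dist_sym u p; have sduw := dist_sym u w; move: (b); rewrite /btw => bE.
have dpq : 1 < dist p q by lia.
have pq : p != q by apply: contraTneq dpq => ->; rewrite dist_xx.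
suff : e p q by move/dist_edge; lia.
apply: (neighbours_adjacent ewp ewq pq).
apply: (@connect_trans _ _ u); last apply: (connect_trans cuv).
  by apply: geodesic_avoids; rewrite /btw (dist_sym p w); lia.
by rewrite connect_rel_in_sym; apply: geodesic_avoids; rewrite /btw (dist_sym q w); lia.
Qed.

(** If both alternatives fail, geodesics from [z] to [u] and to [v] avoid [w] and join [u] to [v],
    against [btw_separates]. *)
Lemma btw_gate z u w v : btw u w v -> btw z w u || btw z w v.
Proof.
move=> b; have [->|wu] := eqVneq w u; first by rewrite /btw dist_xx addn0 eqxx.
have [->|wv] := eqVneq w v; first by rewrite /btw dist_xx addn0 eqxx orbT.
apply: contraT; rewrite negb_or => /andP[/geodesic_avoids czu /geodesic_avoids czv].
move: (btw_separates b wu wv); rewrite (connect_trans _ czv) //.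
by rewrite connect_rel_in_sym.
Qed.

Local Notation C := (center e).
Local Notation rad := (rad e).
Local Notation diam := (diam e).

(** * The center *)

Lemma dist_ecc u v : dist u v <= ecc e v.
Proof. exact: (leq_bigmax (F := fun u => dist u v)). Qed.

Lemma ecc_attained v : exists u, dist u v = ecc e v.
Proof.
have [|u du] := @eq_bigmax T (fun u => dist u v); last by exists u; rewrite /ecc du.
by apply/card_gt0P; exists v.
Qed.

Lemma ecc_diam v : ecc e v <= diam.
Proof.
have [u <-] := ecc_attained v; rewrite dist_sym.
by apply: leq_trans (leq_bigmax v); exact: (leq_bigmax (F := fun u => dist v u)).
Qed.

Lemma dist_diam u v : dist u v <= diam.
Proof. exact: leq_trans (dist_ecc u v) (ecc_diam v). Qed.

Lemma rad_leq_ecc v : rad <= ecc e v.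
Proof. exact: (bigminn_leq (P := xpredT)). Qed.

Lemma in_center c : (c \in C) = (ecc e c <= rad).
Proof. by rewrite inE eqn_leq rad_leq_ecc andbT. Qed.

Lemma dist_center_leq c u : c \in C -> dist u c <= rad.
Proof. by rewrite in_center; apply: leq_trans; exact: dist_ecc. Qed.

Lemma center_exists : T -> exists c, c \in C.
Proof.
move=> v; have [|c _ ec] := @bigminn_attained T xpredT (ecc e) #|T| v isT.
  have [u <-] := ecc_attained v.
  by apply: leq_trans (find_size _ _) _; rewrite size_iota.
by exists c; rewrite inE ec.
Qed.

(** Apply [btw_gate] to a vertex [z] farthest from [w]. *)
Lemma ecc_btw u w v : btw u w v ->
  ecc e w + dist w u <= ecc e u \/ ecc e w + dist w v <= ecc e v.
Proof.
have [z <-] := ecc_attained w => b.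
have /orP[/eqP->|/eqP->] := btw_gate z b; [left | right]; exact: dist_ecc.
Qed.

Lemma center_clique : is_clique e C.
Proof.
move=> a b; rewrite !in_center => aC bC ab; apply: edge_of_dist => //.
have [w [_ bw d1 d2]] := next_vertex ab; have := rad_leq_ecc w.
by rewrite dist_sym in d1; case: (ecc_btw bw); lia.
Qed.

Hypothesis diam_gt1 : 1 < diam.

Lemma diam_attained : exists u v, dist u v = diam.
Proof.
have T0 : 0 < #|T|.
  rewrite lt0n; apply: contraTneq diam_gt1 => /card0_eq T0.
  by rewrite /Defs.diam big1 // => x; have := T0 x; rewrite inE.
have [u du] := @eq_bigmax T (fun u => \max_v dist u v) T0.
have [v dv] := @eq_bigmax T (fun v => dist u v) T0.
by exists u, v; rewrite /Defs.diam du dv.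
Qed.

Lemma diam_leq : diam <= rad + rad.
Proof.
have [u [v <-]] := diam_attained; have [c cC] := center_exists u.
have := dist_triangle c u v; have := dist_center_leq u cC.
by have := dist_center_leq v cC; rewrite (dist_sym v); lia.
Qed.

Lemma rad_gt0 : 0 < rad.
Proof. by have := diam_leq; lia. Qed.

(** Take for [a] the neighbour of a central [c] towards a vertex [x] at distance [rad]. For [y]
    farthest from [a], [btw_gate] puts [a] between [y] and [x], as [a] between [y] and [c] would
    give [ecc e a < rad]. *)
Lemma diam_geq : exists2 a, ecc e a + rad <= diam.+1 & (#|C| <= 1 -> a \notin C).
Proof.
have [u _] := diam_attained; have [c cC] := center_exists u.
have [x dx] := ecc_attained c.
move: (cC); rewrite inE => /eqP ec; rewrite ec in dx.
have cx : c != x by rewrite -dist_eq0 dist_sym dx -lt0n rad_gt0.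
have [a [eca b d1 d2]] := next_vertex cx.
have ca : c != a by rewrite -dist_eq0 d1.
exists a => [|C1]; last first.
  by apply: contra ca => aC; apply/eqP; exact: (card_le1_eqP C1).
have [y dy] := ecc_attained a; have := rad_leq_ecc a.
have := dist_center_leq y cC; have := dist_diam y x.
rewrite (dist_sym c x) (dist_sym c a) dx in d1 d2.
by have /orP[/eqP|/eqP] := btw_gate y b; lia.
Qed.

Lemma diam_even : #|C| <= 1 -> diam = rad + rad.
Proof.
move=> C1; have [a da /(_ C1)] := diam_geq; rewrite in_center.
by have := diam_leq; lia.
Qed.

(** If [dist u v] were [2 rad], two central vertices [a], [b] would both be at distance [rad] from
    [u] and [v]; but [a] then lies between [b] and one of the ends, so [b] is too far from it. *)
Lemma diam_odd : 1 < #|C| -> diam.+1 = rad + rad.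
Proof.
move=> /card_gt1P[a [b [aC bC ab]]]; apply/eqP; rewrite eqn_leq.
have [x] := diam_geq; have := rad_leq_ecc x => rx dx _.
apply/andP; split; last lia.
have [u [v duv]] := diam_attained; rewrite -duv ltnNge; apply/negP => le.
have := dist_triangle a u v; have := dist_triangle b u v.
have := dist_center_leq u aC; have := dist_center_leq u bC.
have := dist_center_leq v aC; have := dist_center_leq v bC.
rewrite (dist_sym v a) (dist_sym v b) => vb va ub ua tb ta.
have bt : btw u a v by rewrite /btw; lia.
have : 0 < dist b a by rewrite lt0n dist_eq0 eq_sym.
by have /orP[/eqP|/eqP] := btw_gate b bt;
  rewrite ?(dist_sym b u) ?(dist_sym a u); lia.
Qed.

(** Either case of [ecc_btw] bounds [ecc e m] by [diam] minus the distance to one end, that is, by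
    the distance to the other end. *)
Lemma diametral_center u m v : dist u v = diam -> btw u m v ->
  dist u m <= rad -> dist m v <= rad -> m \in C.
Proof.
move=> duv b um mv; rewrite in_center; move: (b); rewrite /btw (dist_sym u m).
rewrite dist_sym in um.
have := ecc_diam u; have := ecc_diam v; have := ecc_btw b; lia.
Qed.

(** If [ecc e y > rad], both [a] and [b] lie at distance 1 from [y] on geodesics to a farthest
    vertex, and [btw_gate] for [b] and [a] is violated. *)
Lemma center_triangle a b y : a \in C -> b \in C -> a != b -> e y a -> e y b ->
  y \in C.
Proof.
move=> aC bC ab /dist_edge ya /dist_edge yb; rewrite in_center.
have [z dz] := ecc_attained y; have za := dist_center_leq z aC.
have zb := dist_center_leq z bC; rewrite leqNgt; apply/negP => lt.
have := dist_triangle a z y; have := dist_triangle b z y.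
rewrite (dist_sym a y) (dist_sym b y) => tb ta.
have bt : btw y a z by rewrite /btw (dist_sym a z) (dist_sym y z); lia.
have : 0 < dist b a by rewrite lt0n dist_eq0 eq_sym.
by have /orP[/eqP|/eqP] := btw_gate b bt;
  rewrite ?(dist_sym b y) ?(dist_sym a y) ?(dist_sym b z) ?(dist_sym a z); lia.
Qed.

(** * Components of the graph without the central edges *)

Local Notation cut := (cut_rel e).

Lemma cut_even x y : #|C| <= 1 -> cut x y = [&& e x y, x \notin C & y \notin C].
Proof. by rewrite /cut_rel ltnNge => -> /=; rewrite negb_or. Qed.

Lemma cut_odd x y : 1 < #|C| -> cut x y = e x y && ~~ ((x \in C) && (y \in C)).
Proof. by rewrite /cut_rel => ->. Qed.

Lemma cut_sym : connect_sym cut.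
Proof.
apply: sym_connect_sym => x y; have [C1|C1] := leqP #|C| 1.
  by rewrite !cut_even // e_sym [(x \notin C) && _]andbC.
by rewrite !cut_odd // e_sym [(x \in C) && _]andbC.
Qed.

(* An edge leaving the half-space of vertices closer to [a] than to [b] lies in the
   block of [a] and [b], which is the center. *)
Lemma cut_halfspace a b x y : 1 < #|C| -> a \in C -> b \in C -> cut x y ->
  dist x a < dist x b -> dist y a < dist y b.
Proof.
move=> C1 aC bC; rewrite cut_odd // => /andP[exy nC] lt.
have [ab|ab] := eqVneq a b; first by rewrite ab ltnn in lt.
rewrite ltnNge; apply/negP => le.
have dab := dist_edge (center_clique aC bC ab).
have tri := dist_triangle a x b.
have ba : 0 < dist a b by rewrite lt0n dist_eq0.
have bt : btw b a x by rewrite btw_sym /btw; lia.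
have yx := dist_edge exy; rewrite dist_sym in yx.
have /orP[/eqP|/eqP] := btw_gate y bt; first lia.
have [ya|ya] := eqVneq y a; first by move: le; rewrite ya dist_xx; lia.
have ya0 : 0 < dist y a by rewrite lt0n dist_eq0.
move=> yax; have ax : a = x by apply/eqP; rewrite -dist_eq0; lia.
case/negP: nC; rewrite -ax aC /=.
have [->//|yb] := eqVneq y b.
by apply: (center_triangle aC bC ab); apply: edge_of_dist => //; lia.
Qed.

(** With several central vertices, the half-space of [a] against [b] is closed under [cut] and
    separates [u] from [v]. With one, it lies between [u] and [v] and separates them, while no [cut]
    edge meets it. *)
Lemma connect_cut_no_cross u v a b : connect cut u v -> e a b -> ~~ cut a b ->
  dist u a + 1 + dist b v = dist u v -> False.
Proof.
move=> cuv eab nab duv.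
have tri1 := dist_triangle a u b; have tri2 := dist_triangle b u v.
have tri3 := dist_triangle a u v; have tri4 := dist_triangle b a v.
have dab := dist_edge eab.
have [C1|C1] := leqP #|C| 1; last first.
  move: nab; rewrite cut_odd // eab /= negbK => /andP[aC bC].
  have clo : closed cut [pred x | dist x a < dist x b].
    by apply: (intro_closed cut_sym) => x y; exact: cut_halfspace.
  have := closed_connect clo cuv; rewrite !inE (dist_sym v a) (dist_sym v b).
  lia.
have [c cC bt] : exists2 c, c \in C & btw u c v.
  move: nab; rewrite cut_even // eab /= -negb_or negbK => /orP[aC|bC].
    by exists a; rewrite // /btw; lia.
  by exists b; rewrite // /btw; lia.
have [p ep lp] := connectP cuv.
have uv : u != v by rewrite -dist_eq0; lia.
have sub x y : cut x y -> rel_in e [set~ c] x y.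
  rewrite cut_even // /rel_in /= !in_setC1 => /and3P[-> xC yC] /=.
  by apply/andP; split; [apply: contraNneq xC | apply: contraNneq yC] => ->.
have cu : c != u.
  apply: contraNneq uv => cu; case: p ep lp => [_ ->//|x p /= /andP[/sub]].
  by rewrite /rel_in /= cu !inE eqxx andbF.
have cv : c != v.
  have [q eq lq] : exists2 q, path cut v q & u = last v q.
    by apply/connectP; rewrite cut_sym.
  apply: contraNneq uv => cv; case: q eq lq => [_ ->//|x q /= /andP[/sub]].
  by rewrite /rel_in /= cv !inE eqxx andbF.
case/negP: (btw_separates bt cu cv).
by apply: connect_sub cuv => x y /sub; exact: connect1.
Qed.

Lemma cross_edge u v : ~~ connect cut u v ->
  exists a b, [/\ e a b, ~~ cut a b & dist u a + 1 + dist b v = dist u v].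
Proof.
move: {2}(dist u v) (leqnn (dist u v)) => n; elim: n u => [|n IHn] u.
  by rewrite leqn0 dist_eq0 => /eqP->; rewrite connect0.
move=> le ncuv; have uv : u != v by apply: contraNneq ncuv => ->.
have [w [euw _ d1 d2]] := next_vertex uv.
have [cuw|ncuw] := boolP (cut u w); last first.
  by exists u, w; split=> //; rewrite dist_xx; lia.
have [||a [b [eab nab dab]]] := IHn w; first lia.
  by apply: contra ncuv; apply: connect_trans; exact: connect1.
exists a, b; split=> //; have := dist_triangle w u a; have := dist_triangle a u v.
by have := dist_triangle b a v; have := dist_edge eab; lia.
Qed.

(** Components are convex: a removed edge on a geodesic from [u] to [w] would also lie on one from
    [u] to [v]. *)
Lemma connect_cut_btw u w v : connect cut u v -> btw u w v -> connect cut u w.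
Proof.
move=> cuv bt; apply: contraT => /cross_edge[a [b [eab nab dab]]].
exfalso; apply: (connect_cut_no_cross cuv eab nab); move: bt; rewrite /btw.
have := dist_triangle w b v; have := dist_triangle a u v.
by have := dist_triangle b a v; have := dist_edge eab; lia.
Qed.

Lemma cross_center u v : ~~ connect cut u v ->
  exists c, [/\ c \in C, btw u c v & c = u -> #|C| <= 1].
Proof.
move=> /cross_edge[a [b [eab nab dab]]].
have tri1 := dist_triangle a u b; have tri2 := dist_triangle b u v.
have tri3 := dist_triangle a u v; have tri4 := dist_triangle b a v.
have dab1 := dist_edge eab.
have [ba bb] : btw u a v /\ btw u b v by rewrite /btw; lia.
have [C1|C1] := leqP #|C| 1.
  by move: nab; rewrite cut_even // eab /= -negb_or negbK => /orP[]; [exists a | exists b].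
move: nab; rewrite cut_odd // eab /= negbK => /andP[aC bC].
(* The far end of the removed edge is chosen because it differs from [u]. *)
exists b; split=> // bu; move: dab tri2; rewrite bu dist_xx; lia.
Qed.

(** Central vertices [c] and [c'] occur on the two sides of [w] and are equal or adjacent, so [w] is
    one of them; the last clause of [cross_center] then bounds [#|C|]. *)
Lemma isolated_center u w v : btw u w v ->
  ~~ connect cut u w -> ~~ connect cut w v -> #|C| <= 1 /\ w \in C.
Proof.
move=> bt; rewrite cut_sym => /cross_center[c [cC bc cw]].
move=> /cross_center[c' [cC' bc' cw']]; move: bt bc bc'; rewrite /btw.
rewrite (dist_sym w c) (dist_sym c u) (dist_sym w u) => bt bc bc'.
have tri1 := dist_triangle c u v; have tri2 := dist_triangle c' c v.
have [eqc|nc] := eqVneq c c'.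
  suff /eqP eqw : c == w by rewrite -eqw; split=> //; exact: cw.
  by rewrite -dist_eq0; move: bc'; rewrite -eqc (dist_sym w c); lia.
have dcc := dist_edge (center_clique cC cC' nc).
have C1 : 1 < #|C| by apply/card_gt1P; exists c, c'.
have : (c == w) || (w == c') by rewrite -!dist_eq0; lia.
by case/orP => /eqP eqw; [have := cw eqw | have := cw' (esym eqw)]; lia.
Qed.

(** A central [c] lies between [w] and [v]. If [c] is not [w], then [w] lies strictly between [u]
    and [c], and the eccentricity drops towards [c] by [ecc_btw]. *)
Lemma ecc_cross u w v : btw u w v -> w != u -> ~~ connect cut w v ->
  (#|C| <= 1 /\ w \in C) \/ ecc e w < ecc e u.
Proof.
move=> bt wu /cross_center[c [cC bc cw]].
have [eqw|nw] := eqVneq c w; first by left; split; [exact: cw | rewrite -eqw].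
have tri := dist_triangle c u v; have tri' := dist_triangle w u c; right.
have b : btw u w c by move: bt bc; rewrite /btw; lia.
have wu0 : 0 < dist w u by rewrite lt0n dist_eq0.
have cw0 : 0 < dist w c by rewrite lt0n dist_eq0 eq_sym.
have := rad_leq_ecc w; move: cC; rewrite in_center; case: (ecc_btw b); lia.
Qed.

Lemma diametral u v : dist u v = diam -> radial e v /\ ~~ connect cut u v.
Proof.
move=> duv; have r0 := rad_gt0; have le := diam_leq.
have rd : rad <= diam.
  by have [x _] := diam_attained; exact: leq_trans (rad_leq_ecc x) (ecc_diam x).
have [|a [ba ua av]] := @dist_split u v (diam - rad) rad; first lia.
have aC : a \in C by apply: (diametral_center duv ba); lia.
split; first by apply/exists_inP; exists a; rewrite // dist_sym av.
have av0 : a != v by rewrite -dist_eq0; lia.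
have [b [eab bb d1 d2]] := next_vertex av0.
have tri1 := dist_triangle a u b; have tri2 := dist_triangle b u v.
apply/negP => cuv; apply: (connect_cut_no_cross cuv eab); last lia.
have [C1|C1] := leqP #|C| 1; first by rewrite cut_even // aC andbF.
have := diam_odd C1 => dE.
(* Here [b] is at distance [diam - rad + 1 = rad] from [u], so [b] is central too and the edge [a b]
   is removed. *)
rewrite cut_odd // aC eab negbK; apply: (diametral_center duv); rewrite /btw; lia.
Qed.

(** A geodesic passes through the single central vertex, or through a central edge whose ends are at
    distance at least [rad - 1] from every radial vertex. *)
Lemma radial_dist u v : radial e u -> radial e v -> ~~ connect cut u v ->
  dist u v = diam.
Proof.
have [C1|C1] := leqP #|C| 1.
  move=> /exists_inP[c cC /eqP uc] /exists_inP[c' cC' /eqP vc'].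
  move=> /cross_center[x [xC bt _]]; move: uc vc' bt; rewrite /btw diam_even //.
  by rewrite (card_le1_eqP C1 _ _ xC cC) (card_le1_eqP C1 _ _ xC cC') (dist_sym v); lia.
have far x a : radial e x -> a \in C -> rad <= (dist x a).+1.
  move=> /exists_inP[c cC /eqP <-] aC; have := dist_triangle a x c.
  have [->|ac] := eqVneq a c; first lia.
  have := dist_edge (center_clique aC cC ac); lia.
move=> ru rv /cross_edge[a [b [eab]]].
rewrite cut_odd // eab /= negbK => /andP[aC bC].
have := far u a ru aC; have := far v b rv bC; have := dist_diam u v.
have := diam_odd C1; rewrite (dist_sym v b); lia.
Qed.

(** * Lower bounds *)

Definition btw_free (M : {set T}) :=
  forall u w v, u \in M -> w \in M -> v \in M -> btw u w v -> w = u \/ w = v.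

Lemma btw_free_mvis_k k M : btw_free M ->
  {in M &, forall u v, dist u v <= k} -> mvis_k e k M.
Proof.
move=> free dk; apply/forall_inP => u uM; apply/forall_inP => v vM.
have [p [ep lp sp]] := dist_path u v.
pose t : (dist u v).-tuple T := Tuple (introT eqP sp).
apply/existsP; exists t; rewrite dk // andbT /vis_path /= ep lp eqxx /=.
apply/allP => w wp; apply/negP => wM.
have [p1 [p2 def_p]] : exists p1 p2 : seq T, take (size p).-1 p = rcons p1 w ++ p2.
  by case/splitPr: wp => p1 p2; exists p1, p2; rewrite cat_rcons.
have p0 : 0 < size p by case: (p) def_p => //; case: p1.
have := cat_take_drop (size p).-1 p; rewrite def_p -catA.
have := size_drop (size p).-1 p; move: (drop _ p) => q sq defp.
have bw : btw u w v.
  by rewrite -lp; apply: path_btw; rewrite ?lp // -defp mem_cat mem_rcons inE eqxx.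
move: (ep) lp (sp) sq; rewrite -defp cat_path last_cat last_rcons !size_cat size_rcons.
move=> /andP[/dist_min d1 /dist_min d2] lq.
move: d1 d2; rewrite lq last_rcons size_rcons size_cat => d1 d2 sp' sq'.
(* If [w] were [u], the part of the path after [w] would be too short; if it were [v], the part up
   to [w] would be. *)
move: (bw); rewrite /btw; have [ew|ew] := free _ _ _ uM wM vM bw.
  by move: d2; rewrite ew dist_xx; lia.
by move: d1; rewrite ew dist_xx; lia.
Qed.

Lemma mvis_k_mvis k M : mvis_k e k M -> mvis e M.
Proof.
move=> /forall_inP h; apply/forall_inP => u uM; apply/forall_inP => v vM.
have /forall_inP/(_ v vM)/existsP[p /andP[pv _]] := h u uM.
by apply/existsP; exists p.
Qed.

Lemma mvis_k_dist k M : mvis_k e k M -> {in M &, forall u v, dist u v <= k}.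
Proof.
move=> /forall_inP h u v uM vM.
by have /forall_inP/(_ v vM)/existsP[p /andP[_]] := h u uM.
Qed.

(** A vertex strictly between [u] and [v] separates them, so no path witnessing their visibility can
    avoid it. *)
Lemma mvis_btw_free M : mvis e M -> btw_free M.
Proof.
move=> /forall_inP h u w v uM wM vM bw.
have /forall_inP/(_ v vM)/existsP[p /and3P[ep /eqP lp /allP pM]] := h u uM.
have [->|wu] := eqVneq w u; [by left | have [->|wv] := eqVneq w v; first by right].
case/negP: (btw_separates bw wu wv); rewrite -lp.
apply: (rel_in_path_connect _ ep); last exact: mem_last.
move=> x; rewrite inE in_setC1 => /predU1P[->|]; first by rewrite eq_sym.
move: ep lp pM; case/lastP: (tval p) => // q y _.
rewrite last_rcons size_rcons /= -cats1 take_size_cat // => -> qM.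
rewrite mem_cat inE => /orP[/qM|/eqP->]; last by rewrite eq_sym.
by apply: contraNneq => ->.
Qed.

Lemma partition_geq_diam (P : {set {set T}}) : partition P [set: T] ->
  {in P, forall B, btw_free B} -> uphalf (diam + 1) <= #|P|.
Proof.
move=> pP free; have [u [v duv]] := diam_attained; have [w dw] := geodesic u v.
rewrite duv in dw; pose c (i : 'I_diam.+1) := pblock P (w i).
have inP x : x \in cover P by rewrite (cover_partition pP).
(* Double counting: the geodesic has [diam + 1] vertices, at most two of them in each class. *)
have : \sum_(i : 'I_diam.+1) 1 <= #|P| * 2; last first.
  by rewrite sum1_card card_ord; lia.
rewrite (partition_big c (mem P)) /=; last by move=> i _; exact: pblock_mem.
rewrite -sum_nat_const; apply: leq_sum => B BP; rewrite sum1dep_card leqNgt.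
have three (i j k : 'I_diam.+1) : i < j -> j < k ->
    c i = B -> c j = B -> c k = B -> False.
  have lek := ltn_ord k => ij jk ci cj ck.
  have inB l : c l = B -> w l \in B by move=> <-; rewrite mem_pblock.
  have := dw i j; have := dw j k; have := dw i k => ik jk' ij'.
  have [|ew|ew] := free B BP (w i) (w j) (w k) (inB _ ci) (inB _ cj) (inB _ ck).
  - by rewrite /btw; lia.
  - by move: ij'; rewrite ew dist_xx; lia.
  by move: jk'; rewrite ew dist_xx; lia.
apply/card_gt2P => -[i [j [k [[iB jB kB] [ij jk ki]]]]].
move: iB jB kB; rewrite !inE => /eqP iB /eqP jB /eqP kB.
move: ij jk ki; rewrite -!val_eqE /= => ij jk ki.
have : (i < j /\ j < k) \/ (i < k /\ k < j) \/ (j < i /\ i < k) \/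
       (j < k /\ k < i) \/ (k < i /\ i < j) \/ (k < j /\ j < i) by lia.
by case=> [|[|[|[|[|]]]]] [lt1 lt2]; apply: three lt1 lt2 _ _ _.
Qed.

Definition comp x := [set y | connect cut x y].
(** The cardinality of this set is [degstar e] by unfolding. *)
Definition radial_comps := [set comp u | u in [set u | radial e u]].

Lemma eq_comp u v : (comp u == comp v) = connect cut u v.
Proof.
apply/eqP/idP => [E|cuv].
  by move/setP/(_ v): E; rewrite !inE connect0.
by apply/setP => x; rewrite !inE; exact: same_connect cut_sym _ _ cuv x.
Qed.

(** Sending each component to the class of a chosen radial vertex is injective, by [radial_dist]. *)
Lemma partition_geq_radial_comps (P : {set {set T}}) : partition P [set: T] ->
  {in P, forall B : {set T}, {in B &, forall u v, dist u v <= diam.-1}} ->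
  #|radial_comps| <= #|P|.
Proof.
move=> pP dP; have inP x : x \in cover P by rewrite (cover_partition pP).
pose r (D : {set T}) := [pick u | radial e u & comp u == D].
pose g D := if r D is Some u then pblock P u else set0.
have rP D : D \in radial_comps -> exists u, [/\ r D = Some u, radial e u & comp u = D].
  move=> /imsetP[u]; rewrite inE /r => ru ->.
  case: pickP => [v /andP[rv /eqP cv]|/(_ u)]; first by exists v.
  by rewrite ru eqxx.
rewrite -(card_in_imset (f := g)); last first.
  move=> D D' /rP[u [rD ru cD]] /rP[v [rD' rv cD']]; rewrite /g rD rD' -cD -cD' => E.
  apply/eqP; rewrite eq_comp; apply: contraT => /(radial_dist ru rv) duv.
  have : dist u v <= diam.-1.
    apply: (dP (pblock P u)); rewrite ?pblock_mem ?mem_pblock //.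
    by rewrite E mem_pblock.
  by rewrite duv; lia.
apply/subset_leq_card/subsetP => B /imsetP[D /rP[u [rD _ _]] ->].
by rewrite /g rD pblock_mem.
Qed.

Lemma center_isolated w u : #|C| <= 1 -> w \in C -> connect cut w u -> u = w.
Proof.
move=> C1 wC /connectP[[_ ->//|x p /= /andP[]]].
by rewrite cut_even // wC andbF.
Qed.

(** Both sides are [rad + 1] for a single central vertex and [rad] otherwise. *)
Lemma num_levels : uphalf (diam + 1) = (diam - rad).+1.
Proof.
have [/diam_even|/diam_odd] := leqP #|C| 1; lia.
Qed.

(** * The colouring *)

Definition level x := ecc e x - rad.

Lemma level_btw u w v : btw u w v -> level u = level w -> level v = level w ->
  w = u \/ w = v.
Proof.
move=> bw; have := rad_leq_ecc u; have := rad_leq_ecc v; have := rad_leq_ecc w.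
rewrite /level => ? ? ? lu lv.
have [E|E] := ecc_btw bw; [left | right]; apply/eqP; rewrite -dist_eq0; lia.
Qed.

Lemma level_leq x : level x <= diam - rad.
Proof. by rewrite /level leq_sub2r // ecc_diam. Qed.

(* The default [diam - rad] makes [color] below equal to [level] on the components
   without radial vertices, in particular on the center if it is a single vertex. *)
Definition comp_color x :=
  if comp x \in radial_comps then index (comp x) (enum radial_comps)
  else diam - rad.

(** Within a component this renames levels injectively; a vertex of top level gets the colour
    [comp_color x]. *)
Definition color x := swap (diam - rad) (comp_color x) (level x).

Lemma comp_color_connect u v : connect cut u v -> comp_color u = comp_color v.
Proof. by rewrite -eq_comp /comp_color => /eqP->. Qed.

Lemma comp_color_inj u v : comp u \in radial_comps -> comp v \in radial_comps ->
  comp_color u = comp_color v -> connect cut u v.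
Proof.
rewrite /comp_color => ru rv; rewrite ru rv -eq_comp => E.
by rewrite -(nth_index set0 (s := enum radial_comps) (x := comp u)) ?mem_enum // E
  nth_index ?mem_enum.
Qed.

Lemma radial_comp u : radial e u -> comp u \in radial_comps.
Proof. by move=> ru; apply/imsetP; exists u; rewrite ?inE. Qed.

Hypothesis few_comps : #|radial_comps| <= (diam - rad).+1.

Lemma color_leq x : color x <= diam - rad.
Proof.
have := level_leq x; suff : comp_color x <= diam - rad.
  by rewrite /color /swap; do !case: ifP.
rewrite /comp_color; case: ifP => // rx; rewrite -ltnS.
by apply: leq_trans few_comps; rewrite cardE index_mem mem_enum.
Qed.

Lemma color_dist u v : color u = color v -> dist u v <= diam.-1.
Proof.
move=> E; rewrite leqNgt; apply/negP => lt.
have duv : dist u v = diam by have := dist_diam u v; lia.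
have dvu : dist v u = diam by rewrite dist_sym.
have [rv nc] := diametral duv; have [ru _] := diametral dvu.
have lv : level v = diam - rad.
  by rewrite /level; have := dist_ecc u v; have := ecc_diam v; lia.
have lu : level u = diam - rad.
  by rewrite /level; have := dist_ecc v u; have := ecc_diam u; lia.
case/negP: nc; apply: comp_color_inj; rewrite ?radial_comp //.
by move: E; rewrite /color /swap lu lv eqxx.
Qed.

Lemma color_center w : #|C| <= 1 -> w \in C -> color w = 0.
Proof.
move=> C1 wC; have lw : level w = 0 by move: wC; rewrite in_center /level; lia.
suff /negPf nr : comp w \notin radial_comps.
  by rewrite /color /comp_color nr /swap lw; case: eqP.
apply/imsetP => -[u]; rewrite inE => ru /eqP; rewrite eq_comp.
move=> /(center_isolated C1 wC) uw; have /exists_inP[c cC] := ru.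
by rewrite uw (card_le1_eqP C1 _ _ wC cC) dist_xx eq_sym (gtn_eqF rad_gt0).
Qed.

Lemma color_center_btw u w v : #|C| <= 1 -> w \in C -> btw u w v ->
  color u = color w -> color v = color w -> w = u \/ w = v.
Proof.
move=> C1 wC bw; rewrite (color_center C1 wC) => cu cv.
have [->|wu] := eqVneq w u; [by left | have [->|wv] := eqVneq w v; first by right].
(* Off the center the level is positive, so colour 0 arises only by exchanging the top level with
   level 0, which happens in a single radial component. *)
have zero x : w != x -> color x = 0 ->
    comp_color x = 0 /\ comp x \in radial_comps.
  move=> wx; have lx0 : 0 < level x.
    rewrite lt0n; apply: contraNneq wx => lx; apply/eqP.
    by apply: (card_le1_eqP C1) => //; rewrite in_center; move: lx; rewrite /level; lia.
  have := level_leq x; rewrite /color /swap => lx c0.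
  have J0 : comp_color x = 0.
    by move: c0; do 2 (case: eqP => // ?); lia.
  by split=> //; move: J0; rewrite /comp_color; case: ifP => // _; lia.
have [u0 ru] := zero u wu cu; have [v0 rv] := zero v wv cv.
have cuv : connect cut u v by apply: comp_color_inj; rewrite ?u0 ?v0.
left; apply/esym/(center_isolated C1 wC); rewrite cut_sym.
exact: connect_cut_btw cuv bw.
Qed.

(** If [u] and [v] are in the component of [w], [level_btw] applies. If just one is, [ecc_cross]
    contradicts its equal level unless [w] is the only central vertex, as it must be if neither
    is. *)
Lemma color_btw u w v : btw u w v -> color u = color w -> color v = color w ->
  w = u \/ w = v.
Proof.
move=> bw cu cv.
have lev x : connect cut x w -> color x = color w -> level x = level w.
  by move=> /comp_color_connect cx; rewrite /color cx => /swap_inj.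
have ecc_lev x : level x = level w -> ecc e x = ecc e w.
  by have := rad_leq_ecc x; have := rad_leq_ecc w; rewrite /level; lia.
have [->|wu] := eqVneq w u; [by left | have [->|wv] := eqVneq w v; first by right].
have wb : btw v w u by rewrite btw_sym.
have [cuw|nuw] := boolP (connect cut u w); have [cvw|nvw] := boolP (connect cut v w).
- by apply: level_btw; rewrite ?lev.
- case: (ecc_cross bw wu); [by rewrite cut_sym | | by rewrite (ecc_lev u) ?ltnn ?lev].
  by case=> C1 wC; exact: color_center_btw.
- case: (ecc_cross wb wv); [by rewrite cut_sym | | by rewrite (ecc_lev v) ?ltnn ?lev].
  by case=> C1 wC; exact: color_center_btw.
have [||C1 wC] := isolated_center bw; rewrite ?[connect cut w v]cut_sym //.
exact: color_center_btw.
Qed.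

End BlockGraph.

(* ceil((d+1)/2) = uphalf (d+1) *)
Theorem theorem7p1 (T : finType) (e : rel T)
  (e_sym : symmetric e) (e_irr : irreflexive e)
  (G_conn : connected_graph e) (G_block : block_graph e)
  (d : nat) (hd : d = diam e) (hd2 : 2 <= d) :
  chi_mu_k e d.-1 = chi_mu e <-> degstar e <= uphalf (d + 1).
Proof.
subst d.
have single k x : mvis_k e k [set x].
  apply: btw_free_mvis_k => // [u w v|u v].
    by rewrite !inE => /eqP-> /eqP->; left.
  by rewrite !inE => /eqP-> /eqP->; rewrite dist_xx.
have chi_geq : uphalf (diam e + 1) <= chi_mu e.
  have [x|P [pP gP cP]] := @part_num_attained T (mvis e).
    exact: mvis_k_mvis (single 0 x).
  by rewrite /chi_mu -cP; apply: partition_geq_diam => // B /gP /mvis_btw_free; apply.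
have [chik_geq chik_deg] : uphalf (diam e + 1) <= chi_mu_k e (diam e).-1 /\
    degstar e <= chi_mu_k e (diam e).-1.
  have [x|P [pP gP cP]] := @part_num_attained T (mvis_k e (diam e).-1).
    exact: single.
  rewrite /chi_mu_k -cP; split.
    by apply: partition_geq_diam => // B /gP /mvis_k_mvis /mvis_btw_free; apply.
  by apply: partition_geq_radial_comps => // B /gP /mvis_k_dist.
have chi_leq : chi_mu e <= uphalf (diam e + 1).
  rewrite num_levels //.
  apply: leq_trans (geq_minl _ #|T|); apply: (@part_num_leq _ _ (level e)) => x.
    by rewrite ltnS; apply: level_leq.
  (* With [k = diam e] the bound on distances is automatic. *)
  apply: (@mvis_k_mvis _ _ (diam e)); apply: btw_free_mvis_k => //.
    move=> u w v; rewrite !inE => /eqP lu /eqP lw /eqP lv bw.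
    by apply: level_btw bw _ _; rewrite // -lw.
  by move=> u v _ _; apply: dist_diam.
split=> [E|le]; first by apply: leq_trans chik_deg _; rewrite E.
suff : chi_mu_k e (diam e).-1 <= uphalf (diam e + 1) by lia.
rewrite num_levels // in le *.
apply: leq_trans (geq_minl _ #|T|); apply: (@part_num_leq _ _ (color e)) => x.
  by rewrite ltnS; apply: color_leq.
apply: btw_free_mvis_k => // [u w v|u v]; rewrite !inE => /eqP cu /eqP cw.
  by move=> /eqP cv bw; apply: color_btw bw _ _ => //; rewrite -cw.
by apply: color_dist => //; rewrite -cu.
Qed.
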